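(* Let $R$ be a commutative ring with unity whose zero-divisor graph $Z(R)$ has $n$ vertices ($n$ a positive integer) and diameter $k$. If $\mathrm{Mdim}(Z(R)) = 3$, then $$n \leq \frac{k^2(k+3)+2(k+6)}{6}.$$
   Context: For a commutative ring $R$ with unity, the zero-divisor graph $Z(R)$ is the simple undirected graph whose vertices are the nonzero zero divisors of $R$, two distinct vertices $x,y$ being adjacent if and only if $xy=0$. Multiset dimension: for a connected graph $G$ with distance function $d$, a vertex $v$ and a set $B \subseteq V(G)$, let $r_m(v\mid B)$ be the multiset of distances $\{d(v,b) : b \in B\}$ (counted with multiplicity). $B$ is an $m$-resolving set of $G$ if $r_m(u\mid B) \neq r_m(v\mid B)$ for all distinct vertices $u,v$ of $G$. $\mathrm{Mdim}(G)$ is the minimum cardinality of an $m$-resolving set, and $\mathrm{Mdim}(G)=\infty$ if $G$ has no $m$-resolving set. *)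

(* Defs.v *)
From HB Require Import structures.
From mathcomp Require Import all_boot all_order all_algebra.
From mathcomp Require Import finmap multiset.
From mathcomp Require Import boolp classical_sets functions cardinality.

Set Implicit Arguments.
Unset Strict Implicit.
Unset Printing Implicit Defensive.

Import GRing.Theory.

Local Open Scope ring_scope.

(* [None] plays the role of infinity: it is the minimum of the empty set. *)
Definition least (P : nat -> Prop) : option nat :=
  if pselect (exists m, `[< P m >]) is left exP then Some (ex_minn exP)
  else None.

Record sgraph := SGraph {
  vertex :> choiceType;
  adj : rel vertex;
  adj_sym : symmetric adj;
  adj_irrefl : irreflexive adj }.

Section Graphs.
Variable G : sgraph.

Definition gdist (u v : G) : option nat :=
  least (fun m => exists p : seq G,
    [/\ path (@adj G) u p, last u p = v & size p = m]).

Definition is_diameter (k : nat) : Prop :=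
  (forall u v : G, exists2 m, gdist u v = Some m & (m <= k)%N) /\
  (exists u v : G, gdist u v = Some k).

Definition mrepr (v : G) (B : {fset G}) : {mset option nat}%mset :=
  seq_mset [seq gdist v b | b <- enum_fset B].

Definition m_resolving (B : {fset G}) : Prop :=
  forall u v : G, u <> v -> mrepr u B <> mrepr v B.

(* Only finite sets [B] are considered, which is no restriction when [G] is
   finite. *)
Definition Mdim : option nat :=
  least (fun m => exists2 B : {fset G}, m_resolving B & #|` B| = m).

End Graphs.

Section ZeroDivisorGraph.
Variable R : comPzRingType.

Definition zero_divisor (x : R) : Prop := exists2 y : R, y != 0 & x * y = 0.

Definition zd_vertex : choiceType :=
  {x : R | `[< x != 0 /\ zero_divisor x >]}.

Definition zd_adj : rel zd_vertex :=
  fun x y => (x != y) && (val x * val y == 0).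

Lemma zd_adj_sym : symmetric zd_adj.
Proof. by move=> x y; rewrite /zd_adj eq_sym mulrC. Qed.

Lemma zd_adj_irrefl : irreflexive zd_adj.
Proof. by move=> x; rewrite /zd_adj eqxx. Qed.

Definition zd_graph : sgraph := SGraph zd_adj_sym zd_adj_irrefl.

End ZeroDivisorGraph.

(* Main.v *)
Require Import Defs.
From HB Require Import structures.
From mathcomp Require Import all_boot all_order all_algebra.
From mathcomp Require Import finmap multiset.
From mathcomp Require Import boolp classical_sets functions cardinality.
From mathcomp Require Import zify lra.

(** Let B be an m-resolving set with three vertices in a graph of diameter k.
    The vertices of B have codes {0,x,y}, {0,x,z}, {0,y,z}, so x, y, z are
    pairwise distinct and one of them is at least 3. The codes of the other
    vertices are multisets of size 3 in {1..k}; among these {1,1,1} is missed,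
    since a common neighbour of B would force x, y, z <= 2. Hence
    n <= 3 + 'C(k + 2, 3) - 1. *)

Import GRing.Theory Num.Theory.

Local Open Scope ring_scope.
Local Open Scope card_scope.
Local Open Scope classical_set_scope.

Lemma leastP (P : nat -> Prop) (m : nat) :
  least P = Some m -> P m /\ (forall j, P j -> (m <= j)%N).
Proof.
rewrite /least; case: pselect => // exP [<-].
by case: ex_minnP => j /asboolP Pj jmin; split=> // i /asboolP; apply: jmin.
Qed.

(** The default 0 is never reached once [diameter_le] holds, since every [gdist] is then finite. *)
Definition dist {G : sgraph} (u v : G) : nat := odflt 0%N (gdist u v).

(** Sorting picks a canonical list for the multiset of distances, so that equality of multisets
    becomes equality of lists. *)
Definition code {G : sgraph} (B : seq G) (v : G) : seq nat :=
  sort leq [seq dist v b | b <- B].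

Definition diameter_le (G : sgraph) (k : nat) : Prop :=
  forall u v : G, exists2 m, gdist u v = Some m & (m <= k)%N.

Section Distance.
Context {G : sgraph} {k : nat} (Gk : diameter_le G k).

Lemma gdistE (u v : G) : gdist u v = Some (dist u v).
Proof. by rewrite /dist; have [m ->] := Gk u v. Qed.

Lemma dist_le (u v : G) : (dist u v <= k)%N.
Proof. by rewrite /dist; have [m ->] := Gk u v. Qed.

Lemma dist_walk (u v : G) :
  exists p, [/\ path (@adj G) u p, last u p = v & size p = dist u v].
Proof. by have [] := leastP _ _ (gdistE u v). Qed.

Lemma dist_min (u v : G) (p : seq G) :
  path (@adj G) u p -> last u p = v -> (dist u v <= size p)%N.
Proof.
by move=> pP pl; have [_] := leastP _ _ (gdistE u v); apply; exists p.
Qed.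

Lemma distxx (u : G) : dist u u = 0%N.
Proof. by apply/eqP; rewrite -leqn0; apply: (@dist_min u u [::]). Qed.

Lemma dist_gt0 (u v : G) : u != v -> (0 < dist u v)%N.
Proof.
by have [[|x p] [_ /= l <-]] // := dist_walk u v; rewrite l eqxx.
Qed.

Lemma dist_sym_le (u v : G) : (dist v u <= dist u v)%N.
Proof.
have [p [pP pl <-]] := dist_walk u v.
(* A shortest walk read backwards, [rev (belast u p)], is a walk from [v] to [u] of the same
   length. *)
rewrite -(size_belast u) -size_rev; apply: dist_min.
  rewrite -pl rev_path; apply: sub_path pP => x y /=.
  by rewrite adj_sym.
by case: p pl {pP} => [|x p] //= _; rewrite rev_cons last_rcons.
Qed.

Lemma dist_sym (u v : G) : dist u v = dist v u.
Proof. by apply/eqP; rewrite eqn_leq !dist_sym_le. Qed.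

Lemma dist_triangle (u v w : G) :
  (dist u w <= dist u v + dist v w)%N.
Proof.
have [p [pP pl <-]] := dist_walk u v; have [q [qP ql <-]] := dist_walk v w.
rewrite -size_cat; apply: dist_min; first by rewrite cat_path pP pl qP.
by rewrite last_cat pl.
Qed.

Lemma code_inj (B : {fset G}) : m_resolving B -> injective (code B).
Proof.
move=> Bres u v /perm_sortP uv; apply/eqP/negPn/negP => /eqP /Bres; apply.
apply/eq_seq_msetP; rewrite (eq_map (gdistE u)) (eq_map (gdistE v)).
rewrite (map_comp Some (dist u)) (map_comp Some (dist v)).
apply: perm_map; apply: uv.
- exact: leq_total.
- exact: leq_trans.
- exact: anti_leq.
Qed.

Lemma code_perm (B : seq G) (v : G) :
  perm_eq (code B v) [seq dist v b | b <- B].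
Proof. by rewrite /code perm_sort. Qed.

(** Any two of the three pairs share a point; if their distances agree, the other two points get the
    same code. *)
Lemma triple_dist_uniq (a b c : G) : uniq [:: a; b; c] ->
  injective (code [:: a; b; c]) ->
  uniq [:: dist a b; dist a c; dist b c].
Proof.
rewrite /= !inE !negb_or !andbT => /andP[/andP[ab ac] bc] inj.
have ne x y : x != y -> ~ perm_eq [seq dist x i | i <- [:: a; b; c]]
                                  [seq dist y i | i <- [:: a; b; c]].
  move=> /eqP xy xyP; apply/xy/inj/perm_sortP => //.
  - exact: leq_total.
  - exact: leq_trans.
  - exact: anti_leq.
have := ne _ _ ab; have := ne _ _ ac; have := ne _ _ bc.
rewrite /= !distxx (dist_sym b a) (dist_sym c a) (dist_sym c b).
move: (dist a b) (dist a c) (dist b c) => x y z.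
move=> hbc hac hab; rewrite -!andbA; apply/and3P; split; apply/eqP => e.
(* Counting the entries that satisfy an arbitrary predicate reduces the permutation to linear
   arithmetic. *)
- by apply: hbc; rewrite e; apply/permP => p /=; lia.
- by apply: hac; rewrite e; apply/permP => p /=; lia.
- by apply: hab; rewrite e; apply/permP => p /=; lia.
Qed.

Lemma code_neq_111 (a b c v : G) : uniq [:: a; b; c] ->
  injective (code [:: a; b; c]) -> code [:: a; b; c] v <> nseq 3 1%N.
Proof.
move=> uB inj e.
have : all (pred1 1%N) [seq dist v i | i <- [:: a; b; c]].
  by rewrite -(perm_all _ (code_perm _ _)) e.
rewrite /= andbT => /and3P[/eqP va /eqP vb /eqP vc].
have := triple_dist_uniq _ _ _ uB inj.
move: uB; rewrite /= !inE !negb_or !andbT => /andP[/andP[ab ac] bc].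
have := dist_gt0 _ _ ab; have := dist_gt0 _ _ ac; have := dist_gt0 _ _ bc.
have := dist_triangle a v b; have := dist_triangle a v c.
have := dist_triangle b v c.
(* Three pairwise distinct distances would all lie in {1, 2}. *)
rewrite (dist_sym a v) (dist_sym b v) va vb vc; lia.
Qed.

Lemma code_outside (B : seq G) (v : G) : v \notin B ->
  all (fun d => 0 < d <= k)%N (code B v).
Proof.
move=> vB; rewrite (perm_all _ (code_perm _ _)); apply/allP => _ /mapP[b bB ->].
by rewrite dist_le dist_gt0 //; apply: contraNneq vB => ->.
Qed.

End Distance.

(* Entries range over {1..k+1}, not {1..k}. *)
Definition multisets3 (k : nat) : seq (seq nat) :=
  [seq [seq (val i).+1 | i <- val t]
     | t <- enum [set t : 3.-tuple 'I_k.+1 | sorted leq (map val t)]%SET].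

Lemma size_multisets3 (k : nat) : size (multisets3 k) = 'C(3 + k, 3).
Proof. by rewrite size_map -cardE card_sorted_tuples. Qed.

Lemma mem_multisets3 (k : nat) (s : seq nat) : size s = 3%N ->
  sorted leq s -> all (fun d => 0 < d <= k.+1)%N s -> s \in multisets3 k.
Proof.
move=> s3 s_sorted /allP s_range.
have sE : [seq (val (inord d.-1 : 'I_k.+1)).+1 | d <- s] = s.
  rewrite -[RHS]map_id; apply/eq_in_map => d /s_range /andP[d0 dk].
  by rewrite /= inordK; lia.
(* The entries are lowered by one to become ordinals; [sE] undoes this shift, and sortedness is
   tested after it since [succn] preserves and reflects the order. *)
apply/mapP; exists (tcast s3 (map_tuple (fun d => inord d.-1) (in_tuple s))).
  rewrite mem_enum inE val_tcast /= -(mono_sorted (f := succn) (e := leq) (e' := leq)) //.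
  by rewrite -!map_comp sE.
by rewrite /= val_tcast /= -map_comp sE.
Qed.

Lemma card_mdim3 (G : sgraph) (k : nat) (s : seq G) :
  diameter_le G k -> Mdim G = Some 3%N -> uniq s ->
  (size s <= 'C(k.+2, 3) + 2)%N.
Proof.
move=> Gk /leastP[[B Bres B3] _] us.
have inj := code_inj Gk _ Bres.
have uB : uniq B := fset_uniq B.
have [a [b [c Babc]]] : exists a b c, enum_fset B = [:: a; b; c].
  move: B3; case: (enum_fset B) => [|a [|b [|c []]]] //.
  by exists a, b, c.
rewrite Babc in uB inj.
have k0 : (0 < k)%N.
  have ab : a != b by move: uB; rewrite /= !inE; case: (a == b).
  exact: leq_trans (dist_gt0 Gk _ _ ab) (dist_le Gk a b).
(* The diameter bound is now [k.+1], matching the range {1..k+1} of [multisets3 k]. *)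
case: k k0 Gk => // k _ Gk.
have T1 : nseq 3 1%N \in multisets3 k by apply: mem_multisets3.
set T := rem (nseq 3 1%N) (multisets3 k).
have sub : {subset [seq code [:: a; b; c] v | v <- s] <=
             [seq code [:: a; b; c] v | v <- [:: a; b; c]] ++ T}.
  move=> _ /mapP[v _ ->]; rewrite mem_cat.
  have [vB|vB] := boolP (v \in [:: a; b; c]); first by rewrite map_f.
  rewrite orbC; have : code [:: a; b; c] v \in multisets3 k.
    apply: mem_multisets3; first by rewrite size_sort.
      exact/sort_sorted/leq_total.
    exact: (code_outside Gk).
  rewrite (perm_mem (perm_to_rem T1)) inE => /orP[/eqP|-> //].
  by move/(code_neq_111 Gk _ _ _ v uB inj).
(* As [code] is injective, the codes of [s] are distinct, so [s] is no longer than the list that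
   contains them. *)
have := uniq_leq_size _ sub; rewrite map_inj_uniq // => /(_ us).
rewrite size_cat !size_map size_rem // size_multisets3.
(* Positivity keeps the predecessor coming from [size_rem] from being truncated. *)
have : (0 < 'C(3 + k, 3))%N by rewrite bin_gt0; lia.
by rewrite !addSn add0n; lia.
Qed.

Theorem theorem4p2 (R : comPzRingType) (n k : nat)
    (n_gt0 : (0 < n)%N)
    (card_n : [set: zd_graph R] #= `I_n)
    (diam_k : is_diameter (zd_graph R) k)
    (mdim3 : Mdim (zd_graph R) = Some 3%N) :
  (n%:R : rat) <= (k%:R ^+ 2 * (k%:R + 3) + 2 * (k%:R + 6)) / 6.
Proof.
have [diam_le _] := diam_k.
have := card_mdim3 _ _ _ diam_le mdim3 (fset_uniq (fset_set [set: zd_graph R])).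
have -> : size (enum_fset (fset_set [set: zd_graph R])) = n.
  exact: card_fset_set.
move=> n_le.
(* Here 6 'C(k + 2, 3) = (k + 2)(k + 1)k, and adding 12 gives exactly k^2 (k + 3) + 2 (k + 6). *)
have {n_le} : (6 * n <= k.+2 * (k.+1 * k) + 12)%N.
  have := bin_ffact k.+2 3; rewrite !ffactnS ffactn0 /= muln1 (_ : 3`! = 6)%N //.
  lia.
rewrite -(ler_nat rat) !natrD !natrM -!natr1 => h.
rewrite ler_pdivlMr //; lra.
Qed.
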